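(* Let $m$ be a continuous partial action of a countable discrete group $G$ on a Polish space $\mathbb{X}$ such that $\mathbb{X}_g$ is clopen for all $g\in G$. Let $\theta$ be the action of $G$ on $(\{0,1\}^G)^{\mathbb{N}}$ given by $\theta(g,(F_n)_n)=(gF_n)_n$. Then there is a Borel measurable embedding (injective Borel map) $\pi:\mathbb{X}\to(\{0,1\}^G)^{\mathbb{N}}$ such that $m$ and $\theta\restriction\pi[\mathbb{X}]$ are Borel isomorphic, where $\theta\restriction\pi[\mathbb{X}]$ denotes the partial action induced by $\theta$ on $\pi[\mathbb{X}]$. In particular, the enveloping space $\mathbb{X}_G$ is Borel isomorphic to $G\cdot\pi[\mathbb{X}]=\{\theta(g,z): g\in G,\ z\in\pi[\mathbb{X}]\}$, the saturation of $\pi[\mathbb{X}]$ inside $(\{0,1\}^G)^{\mathbb{N}}$.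
   Context: Subsets of $G$ are identified with their characteristic functions, so $\{0,1\}^G$ (product topology) is the collection of subsets of $G$; for $g\in G$ and $F\subseteq G$, $gF=\{gh:h\in F\}$. $(\{0,1\}^G)^{\mathbb{N}}$ has the product topology. A Polish space is a separable, completely metrizable space. A partial action of a group $G$ (identity $1$) on a set $\mathbb{X}$ is a partially defined function $m$ from $G\times\mathbb{X}$ to $\mathbb{X}$, written $(g,x)\mapsto g\cdot x$, such that for all $g,h\in G$, $x\in\mathbb{X}$: (PA1) if $g\cdot x$ is defined then $g^{-1}\cdot(g\cdot x)$ is defined and equals $x$; (PA2) if $g\cdot(h\cdot x)$ is defined then $(gh)\cdot x$ is defined and $g\cdot(h\cdot x)=(gh)\cdot x$; (PA3) $1\cdot x$ is defined and equals $x$. Put $G*\mathbb{X}=\{(g,x): g\cdot x \text{ is defined}\}$, $\mathbb{X}_{g^{-1}}=\{x\in\mathbb{X}: g\cdot x\text{ is defined}\}$, and $m_g:\mathbb{X}_{g^{-1}}\to\mathbb{X}_g$, $x\mapsto g\cdot x$ (a bijection). For a topological group $G$ and a space $\mathbb{X}$, the partial action is topological if each $\mathbb{X}_g$ is open and each $m_g$ is a homeomorphism; it is continuous if moreover $m:G*\mathbb{X}\to\mathbb{X}$ is continuous ($G*\mathbb{X}$ with the subspace topology of the product). If $u:G\times\mathbb{U}\to\mathbb{U}$ is an action and $\mathbb{Y}\subseteq\mathbb{U}$, the induced partial action on $\mathbb{Y}$ has $\mathbb{Y}_g=\mathbb{Y}\cap u_g(\mathbb{Y})$, and the partial map of $g$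 is the restriction of $u_g$ to $\mathbb{Y}_{g^{-1}}$. The enveloping space $\mathbb{X}_G$ is the quotient space $(G\times\mathbb{X})/R$, where $(g,x)R(h,y)$ iff $x\in\mathbb{X}_{g^{-1}h}$ and $m_{h^{-1}g}(x)=y$. A Borel isomorphism between topological spaces is a Borel measurable bijection with Borel measurable inverse. Partial actions $m=\{m_g:\mathbb{X}_{g^{-1}}\to\mathbb{X}_g\}$ and $\theta=\{\theta_g:\mathbb{Y}_{g^{-1}}\to\mathbb{Y}_g\}$ of $G$ are Borel isomorphic if there is a Borel isomorphism $\phi:\mathbb{X}\to\mathbb{Y}$ such that $\phi(\mathbb{X}_g)=\mathbb{Y}_g$ for all $g\in G$ and $\phi(m_g(x))=\theta_g(\phi(x))$ for all $g\in G$, $x\in\mathbb{X}_{g^{-1}}$. *)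

(* Defs.v *)
From HB Require Import structures.
From mathcomp Require Import all_boot all_order all_algebra generic_quotient.
From mathcomp Require Import all_classical all_reals all_analysis.

Set Implicit Arguments.
Unset Strict Implicit.
Unset Printing Implicit Defensive.

Local Open Scope classical_set_scope.
Local Open Scope group_scope.
Local Open Scope quotient_scope.

Definition homeomorphic (S T : topologicalType) : Prop :=
  exists (f : S -> T) (h : T -> S),
    [/\ cancel f h, cancel h f, continuous f & continuous h].

Definition homeomorphism_between (S T : topologicalType)
    (A : set S) (B : set T) (f : S -> T) : Prop :=
  exists h : T -> S,
    [/\ {homo f : x / A x >-> B x}, {homo h : y / B y >-> A y},
        (forall x, A x -> h (f x) = x) & (forall y, B y -> f (h y) = y)]
    /\ {within A, continuous f} /\ {within B, continuous h}.

Definition separable (T : topologicalType) : Prop :=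
  exists2 D : set T, countable D & dense D.

(* The library's [completePseudoMetricType] and [cvg] need a distinguished
   point, whereas a Polish space may be empty; hence the explicit limit. *)
Definition complete_metric (R : realType) (M : metricType R) : Prop :=
  forall F : set_system M, ProperFilter F -> cauchy F -> exists l : M, F --> l.

Definition completely_metrizable (R : realType) (T : topologicalType) : Prop :=
  exists2 M : metricType R, complete_metric M & homeomorphic T M.

Definition polish (R : realType) (T : topologicalType) : Prop :=
  separable T /\ completely_metrizable R T.

(* The library's [measurableType] is pointed; the spaces below may be empty. *)
Definition borel (T : topologicalType) : set_system T := <<s @open T >>.

Definition borel_fun (S T : topologicalType) (f : S -> T) : Prop :=
  forall B : set T, borel B -> borel (f @^-1` B).

Definition borel_isomorphism (S T : topologicalType) (f : S -> T) : Prop :=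
  borel_fun f /\ exists h : T -> S, [/\ cancel f h, cancel h f & borel_fun h].

Definition borel_isomorphic (S T : topologicalType) : Prop :=
  exists f : S -> T, borel_isomorphism f.

(* [m g x = Some y] means that g . x is defined and equal to y. *)
Record partial_action (G : groupType) (X : Type) := PartialAction {
  pact :> G -> X -> option X;
  pactV : forall g x y, pact g x = Some y -> pact g^-1 y = Some x;
  pactM : forall g h x y z,
    pact h x = Some y -> pact g y = Some z -> pact (g * h) x = Some z;
  pact1 : forall x, pact 1 x = Some x
}.

Section PartialActions.
Context {G : groupType}.

(* X_g = {x | g^-1 . x is defined} *)
Definition pa_dom (X : Type) (m : partial_action G X) (g : G) : set X :=
  [set x | m g^-1 x].

(* The total extension of m_g by the identity. It is only used on X_{g^-1}. *)
Definition pa_map (X : Type) (m : partial_action G X) (g : G) (x : X) : X :=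
  odflt x (m g x).

Definition pa_graph_dom (X : Type) (m : partial_action G X) :
    set (discrete_topology G * X) :=
  [set p | m p.1 p.2].

Definition topological_partial_action (X : topologicalType)
    (m : partial_action G X) : Prop :=
  (forall g, open (pa_dom m g)) /\
  (forall g, homeomorphism_between (pa_dom m g^-1) (pa_dom m g) (pa_map m g)).

Definition continuous_partial_action (X : topologicalType)
    (m : partial_action G X) : Prop :=
  topological_partial_action m /\
  {within pa_graph_dom m,
    continuous (fun p : discrete_topology G * X => pa_map m p.1 p.2)}.

Definition borel_isomorphic_actions (X Y : topologicalType)
    (m : partial_action G X) (theta : partial_action G Y) : Prop :=
  exists phi : X -> Y,
    [/\ borel_isomorphism phi,
        (forall g, phi @` pa_dom m g = pa_dom theta g) &
        (forall g x, pa_dom m g^-1 x ->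
           phi (pa_map m g x) = pa_map theta g (phi x))].

End PartialActions.

Record global_action (G : groupType) (U : Type) := GlobalAction {
  gact :> G -> U -> U;
  gact1 : forall u, gact 1 u = u;
  gactM : forall g h u, gact (g * h) u = gact g (gact h u)
}.

Section Induced.
Context {G : groupType} {U : Type} (u : global_action G U) (Y : set U).

(* [insub] restricts the codomain to Y: it is [None] outside Y. *)
Definition induced_fun (g : G) (y : Y) : option Y := insub (u g (val y)).

Lemma induced_funE g (y z : Y) :
  induced_fun g y = Some z <-> u g (val y) = val z.
Proof.
rewrite /induced_fun; split; last by move=> ->; rewrite valK.
by case: insubP => // w _ <- [->].
Qed.

Lemma induced_V g (y z : Y) :
  induced_fun g y = Some z -> induced_fun g^-1 z = Some y.
Proof.
by move=> /induced_funE e; apply/induced_funE; rewrite -e -gactM mulVg gact1.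
Qed.

Lemma induced_M g h (x y z : Y) :
  induced_fun h x = Some y -> induced_fun g y = Some z ->
  induced_fun (g * h) x = Some z.
Proof.
by move=> /induced_funE e /induced_funE f; apply/induced_funE; rewrite gactM e.
Qed.

Lemma induced_1 (y : Y) : induced_fun 1 y = Some y.
Proof. by apply/induced_funE; rewrite gact1. Qed.

Definition induced_action : partial_action G Y :=
  PartialAction induced_V induced_M induced_1.

(* Agreement with the description Y_g = Y `&` u_g(Y), m_g = u_g on Y_{g^-1}. *)
Lemma induced_domE g : val @` pa_dom induced_action g = Y `&` (u g @` Y).
Proof.
apply/seteqP; split=> x; first move=> [y Ey <-].
  have Yv (w : Y) : Y (val w) by exact/set_mem/valP.
  case E: (induced_fun g^-1 y) Ey => [z|]; last by rewrite /pa_dom /= E.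
  split; [exact: Yv|exists (val z); first exact: Yv].
  by move/induced_funE: E => <-; rewrite -gactM mulgV gact1.
move=> [+ [z /mem_set Yz e]]; rewrite -{}e => /mem_set Yx.
have E : induced_fun g^-1 (Sub (u g z) Yx) = Some (Sub z Yz).
  by apply/induced_funE; rewrite !SubK -gactM mulVg gact1.
by exists (Sub (u g z) Yx) => //; rewrite /pa_dom /= E.
Qed.

Lemma induced_mapE g (y : Y) :
  pa_dom induced_action g^-1 y -> val (pa_map induced_action g y) = u g (val y).
Proof.
rewrite /pa_dom /pa_map /= invgK; case E: (induced_fun g y) => [z|//] _ /=.
by move/induced_funE: E.
Qed.

Definition saturation : set U := [set u g z | g in [set: G] & z in Y].

End Induced.

Definition subset_seq (G : groupType) : topologicalType :=
  {ptws nat -> {ptws G -> bool}}.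

Section Shift.
Context {G : groupType}.

(* The characteristic function of gF = {gh | h in F}. *)
Definition translate (g : G) (F : G -> bool) : G -> bool :=
  fun k => `[< [set g * h | h in [set h | F h]] k >].

Lemma translateE g F k : translate g F k = F (g^-1 * k).
Proof.
apply/asboolP/idP => /= [[h Fh <-]|Fk]; first by rewrite mulKg.
by exists (g^-1 * k) => //; rewrite mulVKg.
Qed.

Definition shift_fun (g : G) (F : subset_seq G) : subset_seq G :=
  fun n => translate g (F n).

Lemma shift_1 (F : subset_seq G) : shift_fun 1 F = F.
Proof.
by apply/funext => n; apply/funext => k; rewrite /shift_fun translateE invg1 mul1g.
Qed.

Lemma shift_M g h (F : subset_seq G) :
  shift_fun (g * h) F = shift_fun g (shift_fun h F).
Proof.
apply/funext => n; apply/funext => k.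
by rewrite /shift_fun !translateE invgM mulgA.
Qed.

Definition shift_action : global_action G (subset_seq G) :=
  GlobalAction shift_1 shift_M.

End Shift.

Section Enveloping.
Context {G : groupType} {X : topologicalType} (m : partial_action G X).

Definition env_rel : rel (discrete_topology G * X) := fun p q =>
  let: (g, x) := p in let: (h, y) := q in
  `[< pa_dom m (g^-1 * h) x /\ pa_map m (h^-1 * g) x = y >].

Lemma env_relE (g h : G) (x y : X) :
  env_rel (g, x) (h, y) <-> m (h^-1 * g) x = Some y.
Proof.
rewrite /env_rel /pa_dom /pa_map /= invgM invgK.
split=> [/asboolP[]|E]; last by apply/asboolP; rewrite E.
by case: (m (h^-1 * g) x) => [z|//] _ /= ->.
Qed.

Lemma env_refl : reflexive env_rel.
Proof. by case=> g x; apply/env_relE; rewrite mulVg pact1. Qed.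

Lemma env_sym : symmetric env_rel.
Proof.
have H p q : env_rel p q -> env_rel q p.
  case: p q => [g x] [h y] /env_relE E; apply/env_relE.
  by have := pactV E; rewrite invgM invgK.
by move=> p q; apply/idP/idP; apply: H.
Qed.

Lemma env_trans : transitive env_rel.
Proof.
move=> [h y] [g x] [k z] /env_relE E /env_relE F; apply/env_relE.
by have := pactM E F; rewrite mulgA mulgK.
Qed.

Definition env_equiv : equiv_rel (discrete_topology G * X)%type :=
  EquivRel env_rel env_refl env_sym env_trans.

Definition enveloping_space : topologicalType :=
  quotient_topology {eq_quot env_equiv}.

End Enveloping.

(* Main.v *)
Require Import Defs.
From mathcomp Require Import all_boot all_order all_algebra.
From mathcomp Require Import generic_quotient.
From mathcomp Require Import all_classical all_reals all_analysis.

(** Let (U_n) be a countable base of X and put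
    pi(x)_n = {g | g^-1 . x is defined and belongs to U_n}. Then
    g pi(x) = pi(y) iff g . x is defined and equal to y: the coordinates at 1
    say that y lies in exactly those U_n that contain g . x, and the U_n cover
    X and separate its points. Hence pi is injective and equivariant, and
    [g, x] |-> g pi(x) is a well-defined bijection from the enveloping space
    onto the saturation of pi[X].
    Preimages of the subbasic sets {F | k in F_n} are open, and these generate
    the Borel sets because G is countable; so both maps are Borel. Their
    inverses are even continuous: a point z of the saturation has g in z_n iff
    z = g pi(x) for some x in U_n, so {[g, x] | x in U_n} has the relatively
    open image {z | g in z_n}. *)

Import Order.TTheory GRing.Theory Num.Theory.

Local Open Scope classical_set_scope.

(** * Countable bases and Borel maps *)

Lemma borelC {T : topologicalType} (A : set T) : borel A -> borel (~` A).
Proof. by rewrite -setTD; exact: sigma_algebraCD. Qed.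

Lemma borelI (T : topologicalType) : setI_closed (@borel T).
Proof.
have /sigma_algebraP[] // : sigma_algebra setT (@borel T).
exact: smallest_sigma_algebra.
Qed.

Lemma basis_nbhs {T : topologicalType} {B : set_system T} (x : T) (A : set T) :
  basis B -> nbhs x A -> exists2 b, B b & b x /\ b `<=` A.
Proof. by case=> _ BE /BE[b [Bb bx] bA]; exists b. Qed.

Lemma open_bigcup_basis {T : topologicalType} {B : set_system T} (A : set T) :
  basis B -> open A -> A = \bigcup_(b in [set b | B b /\ b `<=` A]) b.
Proof.
move=> Bb oA; apply/seteqP; split=> [x Ax|x [b [_]]]; last exact.
have [b Bbb [bx bA]] := basis_nbhs x _ Bb (open_nbhs_nbhs (conj oA Ax)).
by exists b.
Qed.

Lemma second_countable_seq {T : topologicalType} :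
  @second_countable T -> exists U : nat -> set T, basis (range U).
Proof.
case=> B cB [Bo Bb].
(* The empty set is added so that the family is nonempty, hence the range of a sequence, even when
   [T] is empty; it does not spoil the base. *)
have /pfcard_geP[B0|[U]] : countable (B `|` [set set0]).
- rewrite -bigcup2E; apply: bigcup_countable => //.
  by move=> -[|[|i]] _; [exact: cB|exact: countable1|exact: countable0].
- by have : (B `|` [set set0]) set0; [right|rewrite B0].
exists U; rewrite (_ : range U = B `|` [set set0]).
  split=> [b [/Bo//|->]|x A /Bb[b [Bb' bx] bA]]; first exact: open0.
  by exists b => //; split => //; left.
exact: surj_image_eq.
Qed.

Lemma countable_bigcup_borel {T : topologicalType} {I : Type} (D : set I)
    (F : I -> set T) :
  countable D -> (forall i, D i -> borel (F i)) -> borel (\bigcup_(i in D) F i).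
Proof.
move=> /countable_injP[f finj] bF.
(* Indices are grouped by their code under the injection [f]. Each group has at most one element,
   which leaves a union over [nat]. *)
rewrite (_ : \bigcup_(i in D) F i =
    \bigcup_n \bigcup_(i in [set i | D i /\ f i = n]) F i); last first.
  apply/seteqP; split=> [x [i Di Fx]|x [n _ [i [Di _] Fx]]]; last by exists i.
  by exists (f i) => //; exists i.
apply: sigma_algebra_bigcup => n.
have [[i [Di fi]]|N] := pselect (exists i, D i /\ f i = n).
  rewrite (_ : [set _ | _] = [set i]) ?bigcup_set1; first exact: bF.
  apply/seteqP; split=> [j [Dj fj]|j ->//].
  by apply: finj; rewrite ?inE// fj.
rewrite (_ : [set _ | _] = set0) ?bigcup_set0; first exact: sigma_algebra0.
by rewrite -subset0 => i Di; apply: N; exists i.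
Qed.

(** The sets with Borel preimage form a sigma-algebra, so it is enough that it contains the open
    sets. *)
Lemma borel_fun_open {S T : topologicalType} (f : S -> T) :
  (forall A, open A -> borel (f @^-1` A)) -> borel_fun f.
Proof.
move=> fo; apply: (@smallest_sub _ _ _ [set B | borel (f @^-1` B)]) => //.
split=> [|A fA|F fF] /=; first by rewrite preimage_set0; exact: sigma_algebra0.
- by rewrite setTD preimage_setC; exact: borelC.
- by rewrite preimage_bigcup; exact: sigma_algebra_bigcup.
Qed.

Lemma borel_fun_basis {S T : topologicalType} {B : set_system T} (f : S -> T) :
  countable B -> basis B -> (forall b, B b -> borel (f @^-1` b)) -> borel_fun f.
Proof.
move=> cB Bb fB; apply: borel_fun_open => A oA.
rewrite (open_bigcup_basis _ Bb oA) preimage_bigcup.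
apply: countable_bigcup_borel => [|b [/fB]//].
by apply: sub_countable cB; apply: subset_card_le => b [].
Qed.

Lemma borel_fun_val {S T : topologicalType} {Y : set T} (f : S -> Y) :
  borel_fun (val \o f) -> borel_fun f.
Proof.
move=> vf; apply: borel_fun_open => _ [A oA <-].
rewrite -comp_preimage; apply: vf; exact: sub_sigma_algebra.
Qed.

Lemma borel_isomorphism_open {S T : topologicalType} (f : S -> T) :
  injective f -> (forall t, exists s, f s = t) -> borel_fun f ->
  (forall A, open A -> open (f @` A)) -> borel_isomorphism f.
Proof.
move=> finj /(_ _)/cid fsurj bf fo; pose h t := sval (fsurj t).
have hK : cancel h f by move=> t; exact: svalP (fsurj t).
have fK : cancel f h by move=> s; apply: finj; rewrite hK.
split=> //; exists h; split=> //; apply: borel_fun_open => A oA.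
apply: sub_sigma_algebra; rewrite (_ : h @^-1` A = f @` A); first exact: fo.
apply/seteqP; split=> [t At|_ [s As <-]]; first by exists (h t).
by rewrite /preimage/= fK.
Qed.

(** * Open sets and convergence in products *)

Lemma open_discrete_prodP {I : choiceType} {T : topologicalType}
    (A : set (discrete_topology I * T)) :
  open A <-> forall i, open [set x | A (i, x)].
Proof.
split=> [oA i|oA].
  rewrite openE => x /= Aix.
  have [[P Q] /= [Pi Qx] PQ] := open_nbhs_nbhs (conj oA Aix).
  apply: filterS Qx => y Qy; apply: (PQ (i, y)).
  by split=> //; exact: nbhs_singleton Pi.
rewrite openE => -[i x] Aix; exists ([set i], [set x | A (i, x)]) => /=.
  by split; [exact: discrete_set1|exact: (open_nbhs_nbhs (conj (oA i) Aix))].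
by move=> [_ y] [/= ->].
Qed.

Lemma cvg_prod_topology {I : Type} {K : I -> topologicalType}
    (F : set_system (prod_topology K)) (f : prod_topology K) : Filter F ->
  (forall i, (fun h => h i) @ F --> f i) -> F --> f.
Proof.
move=> FF Ff; apply/cvg_sup => i A [_ [[B oB <-] Bf] BA].
by apply: filterS BA _; apply: (Ff i); exact: open_nbhs_nbhs.
Qed.

(** * Consequences of being Polish *)

Lemma polish_second_countable (R : realType) (T : topologicalType) :
  polish R T -> @second_countable T.
Proof.
move=> [[D cD dD] [M _ [f [h [fK hK fc hc]]]]].
(* The base consists of the pulled-back balls of radius [1/(n+1)] about the points of a countable
   dense set. *)
pose V (p : T * nat) := f @^-1` (interior (ball (f p.1) p.2.+1%:R^-1)).
exists (V @` (D `*` setT)).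
  by apply: sub_countable (card_image_le _ _) _; apply: countableX.
split=> [_ [p _ <-]|x A xA].
  by apply: open_comp => [? _|]; [exact: fc|exact: open_interior].
have : nbhs (f x) (h @^-1` A) by apply: hc; rewrite /= fK.
case/nbhs_ballP => e /= e0 eA.
(* With [r < e/2] and [f d] within [r/2] of [f x], the ball of radius [r] about [f d] is a
   neighbourhood of [f x] and stays within [r/2 + r < e] of it. *)
have /ltr_add_invr[n] : (0 < e / 2)%R by rewrite divr_gt0.
rewrite add0r; set r := (n.+1%:R^-1)%R => re.
have r0 : (0 < r)%R by rewrite invr_gt0.
have [] := dD (f @^-1` interior (ball (f x) (r / 2))).
- by exists x; apply/nbhsx_ballx; rewrite divr_gt0.
- by apply: open_comp => [? _|]; [exact: fc|exact: open_interior].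
move=> d [/interior_subset xd Dd]; exists (V (d, n)).
  split; first by exists (d, n).
  apply: filterS (nbhsx_ballx (f x) (r / 2)%R _); last by rewrite divr_gt0.
  move=> y xy; rewrite [n.+1%:R^-1%R]splitr.
  by apply: ball_triangle xy; exact: ball_sym.
move=> y /interior_subset/= dy; rewrite -[y]fK; apply: eA => /=.
rewrite [e]splitr; apply: (@ball_triangle _ _ (f d)).
  apply: le_ball xd; apply: le_trans (ltW re).
  by rewrite ler_pdivrMr// ler_peMr// ?ler1n// ltW.
by apply: le_ball dy; exact: ltW.
Qed.

Lemma polish_hausdorff (R : realType) (T : topologicalType) :
  polish R T -> hausdorff_space T.
Proof.
move=> [_ [M _ [f [h [fK hK fc hc]]]]] x y xy.
apply: (can_inj fK); apply: (@metric_hausdorff _ M) => A B Ax By.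
by have [z [Az Bz]] := xy _ _ (fc _ _ Ax) (fc _ _ By); exists (f z).
Qed.

(** * Cylinders in the space of sequences of subsets of [G] *)

Section SubsetSeq.
Context {G : groupType}.

(** Indexing by finite lists of constraints reduces countability of the base to that of lists, and
    makes intersection a concatenation. *)
Definition cylinder (s : seq (nat * G * bool)) : set (subset_seq G) :=
  [set F | forall c, c \in s -> F c.1.1 c.1.2 = c.2].

Lemma open_coordinate (n : nat) (g : G) (b : bool) :
  open [set F : subset_seq G | F n g = b].
Proof.
apply: (@open_comp _ _ (fun F : subset_seq G => F n g) [set b]).
  move=> F _; apply: (@continuous_comp _ _ _
    (fun F : subset_seq G => F n) (fun f : {ptws G -> bool} => f g)).
    exact: (@proj_continuous nat (fun=> {ptws G -> bool}) n).
  exact: (@proj_continuous G (fun=> bool) g).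
exact: discrete_open.
Qed.

Lemma open_cylinder s : open (cylinder s).
Proof.
elim: s => [|c s IH].
  rewrite (_ : cylinder [::] = setT); first exact: openT.
  by apply/seteqP; split.
rewrite (_ : cylinder _ =
  [set F : subset_seq G | F c.1.1 c.1.2 = c.2] `&` cylinder s).
  by apply: openI => //; exact: open_coordinate.
apply/seteqP; split=> [F Fcs|F [Fc Fs] d].
  by split=> [|d ds]; apply: Fcs; rewrite inE ?eqxx// ds orbT.
by rewrite inE => /predU1P[->//|]; exact: Fs.
Qed.

Lemma countable_cylinders : countable [set: G] -> countable (range cylinder).
Proof.
move=> /countable_injP[f finj]; apply: sub_countable (card_image_le _ _) _.
apply/countable_injP.
exists (fun s => choice.pickle [seq (c.1.1, f c.1.2, c.2) | c <- s]).
move=> s t _ _ /(pcan_inj choice.pickleK)/inj_map; apply.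
move=> [[n g] b] [[n' g'] b'] /= [-> + ->].
by move=> /finj->//; rewrite inE.
Qed.

Lemma basis_cylinders : basis (range cylinder).
Proof.
split=> [_ [s _ <-]|F]; first exact: open_cylinder.
set N := filter_from _ _.
have FN : Filter N.
  apply: filter_from_filter.
    by exists (cylinder [::]); split=> //; exists [::].
  move=> _ _ [[s _ <-] Fs] [[t _ <-] Ft]; exists (cylinder (s ++ t)).
    split; first by exists (s ++ t).
    by move=> c; rewrite mem_cat => /orP[/Fs|/Ft].
  by move=> H Hst; split=> c cs; apply: Hst; rewrite mem_cat cs ?orbT.
(* Convergence is tested at each coordinate [(n, g)], where the one constraint fixing the value of
   [F] there suffices. *)
apply: cvg_prod_topology => n; apply: cvg_prod_topology => g A /nbhs_singleton AF.
exists (cylinder [:: (n, g, F n g)]).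
  by split; [exists [:: (n, g, F n g)]|move=> c; rewrite inE => /eqP->].
by move=> H /(_ (n, g, F n g)); rewrite inE eqxx => /(_ isT)/= HF; rewrite /= HF.
Qed.

(** A constraint with value [false] is the complement of one with value [true], and a cylinder is a
    finite intersection of constraints. *)
Lemma borel_fun_subset_seq {S : topologicalType} (f : S -> subset_seq G) :
  countable [set: G] -> (forall n g, borel [set s | f s n g]) -> borel_fun f.
Proof.
move=> cG bf; apply: borel_fun_basis (countable_cylinders cG) basis_cylinders _.
move=> _ [s _ <-]; elim: s => [|c s IH].
  rewrite (_ : _ @^-1` _ = setT); last by apply/seteqP; split.
  by apply: sub_sigma_algebra; exact: openT.
rewrite (_ : _ @^-1` _ = [set x | f x c.1.1 c.1.2 = c.2] `&`
    f @^-1` cylinder s); last first.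
  apply/seteqP; split=> [F Fcs|F [Fc Fs] d].
    by split=> [|d ds]; apply: Fcs; rewrite inE ?eqxx// ds orbT.
  by rewrite inE => /predU1P[->//|]; exact: Fs.
apply: borelI => //; case: c.2; first exact: bf.
rewrite (_ : [set _ | _] = ~` [set x | f x c.1.1 c.1.2]).
  by apply: borelC; exact: bf.
by apply/seteqP; split=> x /=; [move=> ->|move/negP/negbTE].
Qed.

End SubsetSeq.

(** * The itinerary map and its equivariance *)

Section PartialAction.
Local Open Scope group_scope.
Context {G : groupType}.

(** This includes that both sides are undefined together: if [h * g] is defined at [x], going back
    from [y] to [x] by [g^-1] first shows that [h] is defined at [y]. *)
Lemma pact_compE {X : Type} (m : partial_action G X) {g x y} (h : G) :
  m g x = Some y -> m h y = m (h * g) x.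
Proof.
move=> gx; case hy: (m h y) => [z|]; first by rewrite (pactM gx hy).
case hgx: (m (h * g) x) => [z|//].
by have := pactM (pactV gx) hgx; rewrite mulgK hy.
Qed.

Context {X : topologicalType} (m : partial_action G X).

(** The set is the preimage of [U] under a map continuous on an open domain, so relative openness is
    openness. *)
Lemma open_pact (g : G) (U : set X) : topological_partial_action m ->
  open U -> open [set x | exists2 y, m g x = Some y & U y].
Proof.
move=> [mo mh] oU; rewrite (_ : mkset _ = pa_dom m g^-1 `&` pa_map m g @^-1` U).
  apply: (continuous_inP _ (mo _)).1 => //.
  by rewrite -continuous_open_subspace//; have [h [_ [+ _]]] := mh g.
rewrite /pa_dom /pa_map invgK; apply/seteqP; split=> x /=.
  by move=> [y -> Uy].
by case: (m g x) => [y|] /= [] // _ Uy; exists y.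
Qed.

(** The inverse of [g] turns the partial action into left translation of the sets. *)
Definition itinerary (U : nat -> set X) (x : X) : subset_seq G :=
  fun n g => `[< exists2 y, m g^-1 x = Some y & U n y >].

Variable U : nat -> set X.

Lemma shift_itinerary g x n k : shift_action g (itinerary U x) n k =
  `[< exists2 y, m (k^-1 * g) x = Some y & U n y >].
Proof. by rewrite /= /shift_fun translateE /itinerary invgM invgK. Qed.

Hypothesis basisU : basis (range U).
Hypothesis hausdorffX : hausdorff_space X.
Hypothesis topm : topological_partial_action m.

Lemma basis_index x (A : set X) : nbhs x A -> exists2 n, U n x & U n `<=` A.
Proof. by move=> /(basis_nbhs x _ basisU)[_ [n _ <-] [Ux UA]]; exists n. Qed.

Lemma shift_itinerary_eq g x y :
  shift_action g (itinerary U x) = itinerary U y <-> m g x = Some y.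
Proof.
split=> [E|gx].
  have UP n : U n y <-> exists2 z, m g x = Some z & U n z.
    have := congr1 (fun F : subset_seq G => F n 1) E.
    rewrite shift_itinerary /itinerary invg1 mul1g pact1 => {}E.
    split=> [Uy|/asboolP]; last by rewrite E => /asboolP[_ [<-]].
    by apply/asboolP; rewrite E; apply/asboolP; exists y.
  (* Some [U n] contains [y], which already forces [g] to be defined at [x]. Then every basic
     neighbourhood of [y] contains the value [z], and the Hausdorff property gives [z = y]. *)
  have [n /UP[z gx _] _] := basis_index y setT filterT.
  rewrite gx; congr Some; apply: hausdorffX => A B /basis_index[i Uz UA].
  move=> By; have [j Uy UB] := basis_index _ _ By.
  exists z; split; first exact: UA.
  by apply: UB; have /UP[w] := Uy; rewrite gx => -[<-].
apply/funext => n; apply/funext => k.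
by rewrite shift_itinerary /itinerary (pact_compE _ _ gx).
Qed.

Lemma shift_itinerary_eq2 g h x y :
  shift_action g (itinerary U x) = shift_action h (itinerary U y) <->
  m (h^-1 * g) x = Some y.
Proof.
rewrite -shift_itinerary_eq gactM; split=> [->|<-].
  by rewrite -gactM mulVg gact1.
by rewrite -[RHS]gactM mulgV gact1.
Qed.

Lemma itinerary_inj : injective (itinerary U).
Proof.
move=> x y xy; have /shift_itinerary_eq : shift_action 1 (itinerary U x) =
  itinerary U y by rewrite gact1.
by rewrite pact1 => -[].
Qed.

Lemma borel_itinerary : countable [set: G] -> borel_fun (itinerary U).
Proof.
move=> cG; apply: borel_fun_subset_seq => // n g; apply: sub_sigma_algebra.
rewrite (_ : mkset _ = [set x | exists2 y, m g^-1 x = Some y & U n y]).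
  by apply: open_pact => //; apply: basisU.1; exists n.
by apply/seteqP; split=> x /asboolP.
Qed.

Definition itinerary_range (x : X) : range (itinerary U) :=
  SigSub (mem_set (imageT (itinerary U) x)).

Lemma itinerary_range_surj F : exists x, itinerary_range x = F.
Proof.
by case: F => F FU; have [x _ xF] := set_mem FU; exists x; exact/val_inj.
Qed.

Lemma borel_isomorphism_itinerary :
  countable [set: G] -> borel_isomorphism itinerary_range.
Proof.
move=> cG; apply: borel_isomorphism_open.
- by move=> x y /(congr1 val)/itinerary_inj.
- exact: itinerary_range_surj.
- by apply: borel_fun_val; exact: borel_itinerary.
(* The coordinate at [1] of the itinerary of [x] tells whether [x] is in [U n], and [A] is the union
   of the [U n] inside it. *)
move=> A oA; exists (\bigcup_(n in [set n | U n `<=` A])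
    [set F : subset_seq G | F n 1 = true]).
  by apply: bigcup_open => n _; exact: open_coordinate.
apply/seteqP; split=> [F|_ [x Ax <-]].
  have [x <-] := itinerary_range_surj F => -[n /= UA /asboolP[y]].
  by rewrite invg1 pact1 => -[<-] Ux; exists x => //; exact: UA.
have [n Ux UA] := basis_index x _ (open_nbhs_nbhs (conj oA Ax)).
by exists n => //=; apply/asboolP; exists x; rewrite ?invg1 ?pact1.
Qed.

Lemma borel_isomorphic_itinerary : countable [set: G] ->
  borel_isomorphic_actions m (induced_action shift_action (range (itinerary U))).
Proof.
move=> cG; have ind g x y : m g x = Some y -> induced_action shift_action
    (range (itinerary U)) g (itinerary_range x) = Some (itinerary_range y).
  by move=> /shift_itinerary_eq gx; exact/induced_funE.
exists itinerary_range; split; first exact: borel_isomorphism_itinerary.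
- move=> g; apply/seteqP; split=> [_ [x gx <-]|F].
    move: gx; rewrite /pa_dom /=.
    by case E: (m g^-1 x) => [y|//] _; have /= -> := ind _ _ _ E.
  have [x <-] := itinerary_range_surj F; rewrite /pa_dom /=.
  (* If a translate of an itinerary is again an itinerary, [shift_itinerary_eq] shows that the
     partial action is defined there. *)
  case E: (induced_fun _ _ _) => [H|//] _; exists x => //.
  have [y yH] := itinerary_range_surj H; move/induced_funE: E; rewrite -yH.
  by move=> /shift_itinerary_eq; rewrite /pa_dom /= => ->.
- move=> g x; rewrite /pa_dom /pa_map /= invgK.
  case E: (m g x) => [y|//] _ /=.
  by have /= -> := ind _ _ _ E.
Qed.

(** * The enveloping space and the saturation *)

Local Notation saturated := (saturation shift_action (range (itinerary U))).

Lemma mem_saturated g x : shift_action g (itinerary U x) \in saturated.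
Proof.
by apply/mem_set; exists g => //; exists (itinerary U x) => //; exists x.
Qed.

Definition saturated_point (p : discrete_topology G * X) : saturated :=
  SigSub (mem_saturated p.1 p.2).

Definition env_itinerary (q : enveloping_space m) : saturated :=
  saturated_point (repr q).

Local Notation env_class := (\pi_(enveloping_space m)%qT).

Lemma env_classP (q : enveloping_space m) : exists g x, q = env_class (g, x).
Proof. by exists (repr q).1, (repr q).2; rewrite -surjective_pairing reprK. Qed.

Lemma env_class_eq g x h y :
  env_class (g, x) = env_class (h, y) <-> m (h^-1 * g) x = Some y.
Proof.
rewrite -env_relE; split=> [/eqmodP//|E]; exact/eqmodP.
Qed.

(** The canonical representative may be replaced by any other, since equivalent pairs give the same
    translate by [shift_itinerary_eq2]. *)
Lemma env_itinerary_class p : env_itinerary (env_class p) = saturated_point p.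
Proof.
apply/val_inj; rewrite /env_itinerary; move: (reprK (env_class p)).
move: (repr _) => -[h y]; case: p => [g x] /env_class_eq E.
exact/shift_itinerary_eq2.
Qed.

Lemma env_itineraryP g x n k :
  reflect (exists2 y, m (k^-1 * g) x = Some y & U n y)
    ((val (env_itinerary (env_class (g, x))) : subset_seq G) n k).
Proof.
rewrite env_itinerary_class [X in reflect _ X]shift_itinerary; exact: asboolP.
Qed.

Lemma env_itinerary_surj F : exists q, env_itinerary q = F.
Proof.
case: F => F Fs; have [g _ [_ [x _ <-] gxF]] := set_mem Fs.
by exists (env_class (g, x)); rewrite env_itinerary_class; exact/val_inj.
Qed.

(** Openness in the quotient is openness of the preimage in the product, whose first factor is
    discrete. *)
Lemma open_envP (A : set (enveloping_space m)) :
  open A <-> forall g, open [set x | A (env_class (g, x))].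
Proof. exact: (open_discrete_prodP (env_class @^-1` A)). Qed.

Lemma borel_isomorphism_env_itinerary :
  countable [set: G] -> borel_isomorphism env_itinerary.
Proof.
move=> cG; apply: borel_isomorphism_open.
- move=> p q; have [g [x ->]] := env_classP p; have [h [y ->]] := env_classP q.
  rewrite !env_itinerary_class => /(congr1 val) E.
  exact/env_class_eq/shift_itinerary_eq2.
- exact: env_itinerary_surj.
- apply: borel_fun_val; apply: borel_fun_subset_seq => // n k.
  apply: sub_sigma_algebra; apply/open_envP => g.
  rewrite (_ : mkset _ = [set x | exists2 y, m (k^-1 * g) x = Some y & U n y]).
    by apply: open_pact => //; apply: basisU.1; exists n.
  by apply/seteqP; split=> x /env_itineraryP.
move=> A /open_envP oA.
exists (\bigcup_g \bigcup_(n in [set n | forall x, U n x -> A (env_class (g, x))])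
    [set F : subset_seq G | F n g = true]).
  by apply: bigcup_open => g _; apply: bigcup_open => n _; exact: open_coordinate.
apply/seteqP; split=> [F [g _ [n UA]]|_ [p Ap <-]].
  have [q <-] := env_itinerary_surj F; have [h [x ->]] := env_classP q.
  (* The class of [(h, x)] is also that of [(g, y)] with [y] in [U n], so it lies in [A] by the
     choice of [n]. *)
  move=> /env_itineraryP[y hx Uy]; exists (env_class (g, y)); first exact: UA.
  by congr env_itinerary; apply/esym/env_class_eq.
move: Ap; have [g [x ->]] := env_classP p => Agx.
have [n Ux UA] := basis_index x _ (open_nbhs_nbhs (conj (oA g) Agx)).
exists g => //; exists n => //.
by apply/env_itineraryP; exists x => //; rewrite mulVg pact1.
Qed.

End PartialAction.

Theorem theorem5p1 (R : realType) (G : groupType) (X : topologicalType)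
    (m : partial_action G X) :
  countable [set: G] ->
  polish R X ->
  continuous_partial_action m ->
  (forall g : G, clopen (pa_dom m g)) ->
  exists pi : X -> subset_seq G,
    [/\ injective pi,
        borel_fun pi,
        borel_isomorphic_actions m (induced_action shift_action (range pi)) &
        borel_isomorphic (enveloping_space m)
          (saturation shift_action (range pi) : topologicalType)].
Proof.
move=> cG pX [topm _] _.
have [U bU] := second_countable_seq (polish_second_countable _ _ pX).
have hX := polish_hausdorff _ _ pX.
exists (itinerary m U); split.
- exact: itinerary_inj.
- exact: borel_itinerary.
- exact: borel_isomorphic_itinerary.
- by exists (env_itinerary m U); exact: borel_isomorphism_env_itinerary.
Qed.
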